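(* Let $\mathbf{J} = (T,h,\varnothing)$ be an ordinal iterator. Let $T^\dagger$ be the class of all elements $c$ for which there exists $B \in T$ such that $c \notin B$ and $h(B) = B \cup \{c\}$, and define $\gamma : T \to T^\dagger$ by letting $\gamma(B) = c$, where $c$ is the element not in $B$ with $h(B) = B \cup \{c\}$. Thus $h(B) = B \cup \{\gamma(B)\}$ for all $B \in T$. Then: (1) The mapping $\gamma : T \to T^\dagger$ is a bijection. (2) Define a mapping $h^\dagger : T^\dagger \to T^\dagger$ by $h^\dagger = \gamma \circ h \circ \gamma^{-1}$ and an iterator by $\mathbf{J}^\dagger = (T^\dagger, h^\dagger, t^\dagger_0)$, where $t^\dagger_0 = \gamma(\varnothing)$, and so $t^\dagger_0$ is the single element in $h(\varnothing)$. Then $\gamma : \mathbf{J} \to \mathbf{J}^\dagger$ is an isomorphism. (3) $\mathbf{J}^\dagger$ is a Peano iterator. (4) $h(\gamma^{-1}(t)) = \gamma^{-1}(t) \cup \{t\}$ for all $t \in T^\dagger$. (5) Define $\le$ on $T^\dagger$ by letting $t' \le t$ if and only if $\gamma^{-1}(t') \subset \gamma^{-1}(t)$. Then $\le$ is the unique total order on $T^\dagger$ compatible with $\mathbf{J}^\dagger$. (6) $L_t = \gamma^{-1}(t)$ for all $t \in T^\dagger$, where $L_t = \{ t' \in T^\dagger : t' \le t,\ t' \neq t\}$. (7) $h(L_t) = L_t \cup \{t\}$ for all $t \in T^\dagger$.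
   Context: A set $E$ is finite if $\mathcal{P}(E)$ is the only subset $\mathcal{S}$ of the power set $\mathcal{P}(E)$ such that $\varnothing \in \mathcal{S}$ and $F \cup \{e\} \in \mathcal{S}$ whenever $F \in \mathcal{S}$, $F \neq E$ and $e \in E \setminus F$ (this is equivalent to the usual notion of finiteness). $\mathsf{Fin}$ denotes the (proper) class of all finite sets. An iterator is a triple $\mathbf{I} = (X,f,x_0)$ with $X$ a class (a set or a proper class), $f : X \to X$ a mapping and $x_0$ an element of $X$. A subclass $Y$ of $X$ is $f$-invariant if $f(y) \in Y$ for all $y \in Y$. $\mathbf{I}$ is minimal if the only $f$-invariant subclass of $X$ containing $x_0$ is $X$ itself, and it is a Peano iterator if it is minimal, $f$ is injective and $x_0 \notin f(X)$. A total order $\le$ on $X$ is compatible with $\mathbf{I}$ if $x \le f(x)$ for all $x \in X$. A morphism $\mu : (X,f,x_0) \to (Y,g,y_0)$ of iterators is a mapping $\mu : X \to Y$ with $\mu(x_0) = y_0$ and $g \circ \mu = \mu \circ f$; it is an isomorphism if there is a morphism $\nu : (Y,g,y_0) \to (X,f,x_0)$ with $\nu \circ \mu = \mathrm{id}_X$ and $\mu \circ \nu = \mathrm{id}_Y$. An ordinal iterator is a minimal iterator $\mathbf{J} = (T,h,\varnothing)$, with $T$ a subclass of $\mathsf{Fin}$, such that for each $B \in T$ there exists an element $b \notin B$ with $h(B) = B \cup \{b\}$. *)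

(* Defs.v *)
From Stdlib Require Export Relation_Definitions.
From mathcomp Require Export ssreflect ssrfun ssrbool eqtype seq.
From mathcomp Require Export boolp classical_sets functions cardinality.

Set Implicit Arguments.
Unset Strict Implicit.
Unset Printing Implicit Defensive.

Local Open Scope classical_set_scope.

(* Conventions.  The elements of sets range over an arbitrary type U; a finite
   set is an element of [set U], and a class of finite sets is an element of
   [set (set U)].  A class, when it is the carrier of an iterator, is a type;
   [T : set A] is used as a type through the coercion [set_type]
   ([{x : A | x \in T}]), whose projection to A is [val]. *)

Definition powerset_of (U : Type) (E : set U) : set (set U) :=
  [set F | F `<=` E].

Definition Fin (U : Type) : set (set U) :=
  [set E | forall S : set (set U), S `<=` powerset_of E ->
     S set0 ->
     (forall F e, S F -> F <> E -> (E `\` F) e -> S (F `|` [set e])) ->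
     S = powerset_of E].

Lemma Fin_finite_set (U : Type) (E : set U) : Fin E <-> finite_set E.
Proof.
split.
- move=> finE.
  have : (powerset_of E `&` [set F | finite_set F]) E; last by case.
  rewrite (finE (powerset_of E `&` [set F | finite_set F])).
  + by [].
  + by move=> F [].
  + by split=> [x []|]; exact: finite_set0.
  + move=> F e [FE finF] _ [Ee _]; split.
      by move=> x [/FE //|/= ->].
    by rewrite /= finite_setU; split=> //; exact: finite_set1.
- move=> finE S SE S0 SU; apply/seteqP; split=> // F FE.
  have /(@finite_seqP {classic U})[s Fs] : finite_set F.
    exact: sub_finite_set finE.
  move: FE; rewrite {}Fs; elim: s => [_|x s IHs].
    by rewrite set_nil.
  have -> : [set` x :: s] = x |` [set` s].
    apply/seteqP; split=> y /=; rewrite inE.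
      by case/orP=> [/eqP|]; [left|right].
    by case=> [->|->]; rewrite ?eqxx ?orbT.
  move=> xsE.
  have Ss : S [set` s] by apply: IHs => y ys; apply: xsE; right.
  have [xs|xs] := pselect ([set` s] x).
    suff -> : x |` [set` s] = [set` s] by [].
    by apply/seteqP; split=> y; [case=> [->|]|right].
  have Ex : E x by apply: xsE; left.
  rewrite setUC; apply: SU => // sE.
  by apply: xs; rewrite sE.
Qed.

Record iterator := Iterator {
  carrier :> Type;
  step : carrier -> carrier;
  start : carrier }.

Definition invariant_class (X : Type) (f : X -> X) (Y : set X) :=
  forall y, Y y -> Y (f y).

Definition minimal (I : iterator) :=
  forall Y : set I, invariant_class (@step I) Y -> Y (start I) -> Y = setT.

Definition peano (I : iterator) :=
  [/\ minimal I, injective (@step I) & ~ range (@step I) (start I)].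

Definition total_order (X : Type) (le : relation X) :=
  Relation_Definitions.order X le /\ (forall x y, le x y \/ le y x).

Definition compatible (I : iterator) (le : relation I) :=
  forall x, le x (step x).

Definition iter_morphism (I J : iterator) (mu : I -> J) :=
  mu (start I) = start J /\ (@step J) \o mu = mu \o (@step I).

Definition iter_isomorphism (I J : iterator) (mu : I -> J) :=
  iter_morphism mu /\
  exists nu : J -> I,
    [/\ iter_morphism nu, nu \o mu = id & mu \o nu = id].

Record ordinal_iterator (U : Type) := OrdinalIterator {
  oclass : set (set U);
  oclass_Fin : oclass `<=` @Fin U;
  ostep : oclass -> oclass;
  oclass0 : set0 \in oclass;
  ominimal : minimal (Iterator ostep (exist _ set0 oclass0));
  ostepP : forall B : oclass, exists b : U,
    ~ val B b /\ val (ostep B) = val B `|` [set b] }.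

Section Dagger.
Variables (U : Type) (J : ordinal_iterator U).
Local Notation T := (oclass J).
Local Notation h := (@ostep U J).

Definition oempty : T := exist _ set0 (oclass0 J).

Definition oiter : iterator := Iterator h oempty.

Definition dagger : set U :=
  [set c | exists B : T, ~ val B c /\ val (h B) = val B `|` [set c]].

Lemma gamma_subproof (B : T) :
  exists c : dagger, ~ val B (val c) /\ val (h B) = val B `|` [set val c].
Proof.
have [c Bc] := ostepP B.
have dc : c \in dagger by apply: mem_set; exists B.
by exists (exist _ c dc).
Qed.

(* The element c is unique (gamma_unique), so the choice made here is
   immaterial. *)
Definition gamma (B : T) : dagger := sval (cid (gamma_subproof B)).

Lemma gammaP (B : T) :
  ~ val B (val (gamma B)) /\ val (h B) = val B `|` [set val (gamma B)].
Proof. exact: svalP (cid (gamma_subproof B)). Qed.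

Lemma gamma_unique (B : T) (c : U) :
  ~ val B c -> val (h B) = val B `|` [set c] -> c = val (gamma B).
Proof.
move=> Bc hB; have [_ hB'] := gammaP B.
have : (val B `|` [set val (gamma B)]) c by rewrite -hB' hB; right.
by case.
Qed.

(* In the definitions below ginv stands for the inverse of gamma. *)
Variable ginv : dagger -> T.

Definition dagger_step : dagger -> dagger := gamma \o h \o ginv.

Definition dagger_iter : iterator := Iterator dagger_step (gamma oempty).

Definition dagger_le : relation dagger :=
  fun t' t => val (ginv t') `<=` val (ginv t).

Definition segment (t : dagger) : set U :=
  [set val t' | t' in [set t' : dagger | dagger_le t' t /\ t' <> t]].

End Dagger.

(* Main.v *)
Require Import Defs.
From mathcomp Require Import ssreflect ssrfun ssrbool boolp classical_sets.

(** Everything rests on one dichotomy ([subset_or_step_subset]): for B and C in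
    the class T, either C is included in B or h(B) is included in C.  In
    particular T is a chain under inclusion, and nothing in T lies strictly
    between B and h(B).  It is proved by a double induction, minimality of the
    iterator being the induction principle, and the step works because h(B) has
    exactly one element more than B.

    Since gamma(B) lies in h(B) but not in B, the dichotomy makes gamma and h
    injective: if B is not included in C, then h(C) is included in B, so that B
    contains gamma(C) and h(B) is different from h(C).  As the empty set is no
    h(B), J is a Peano iterator, and this is transported to the isomorphic
    iterator on the labels gamma(B) ([peano_isomorphism]).

    The order on labels is inclusion in disguise, so it is total.  Any other
    compatible total order contains it, because C is reached from any B
    included in C by iterating h ([compatible_subset]), and a total order cannot
    be properly contained in another one.  Finally the elements of C are exactly
    the labels of the steps leading from the empty set to C ([mem_step_subset]),
    which identifies C with the initial segment of gamma(C). *)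

Local Open Scope classical_set_scope.

(** * Peano iterators and total orders *)

Lemma peano_isomorphism {I J : iterator} {mu : I -> J} :
  iter_isomorphism mu -> peano I -> peano J.
Proof.
move=> [[mu0 muS] [nu [_ /funeqP nuK /funeqP muK]]] [minI injI startI].
have {}nuK : cancel mu nu := nuK.
have {}muK : cancel nu mu := muK.
have muSE x : step (mu x) = mu (step x) by move/funeqP: muS => /(_ x).
have nuSE y : step y = mu (step (nu y)) by rewrite -muSE muK.
have inj_mu := can_inj nuK.
split.
- move=> Y Yinv Y0; apply/seteqP; split=> // y _.
  have muY : mu @^-1` Y = setT.
    by apply: minI => [x /= Yx|/=]; rewrite ?mu0 // -muSE; exact: Yinv.
  have : (mu @^-1` Y) (nu y) by rewrite muY.
  by rewrite /preimage /= muK.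
- move=> y z; rewrite !nuSE => /inj_mu /injI; exact: (can_inj muK).
- move=> [y _]; rewrite nuSE -mu0 => /inj_mu nuy.
  by apply: startI; exists (nu y).
Qed.

(** If the larger order relates x to y, then either the smaller one does too, or
    it relates y to x, and antisymmetry of the larger one forces x = y. *)
Lemma total_order_sub_eq {X : Type} {le le' : relation X} :
  total_order le -> total_order le' ->
  (forall x y, le x y -> le' x y) -> le = le'.
Proof.
move=> [[le_refl _ _] le_total] [[_ _ le'_anti] _] sub.
apply/funext => x; apply/funext => y; apply/propext; split=> [/sub //|le'xy].
have [//|leyx] := le_total x y.
by rewrite (le'_anti _ _ le'xy (sub _ _ leyx)); exact: le_refl.
Qed.

(** * The chain of an ordinal iterator *)

Section Chain.
Context {U : Type} {J : ordinal_iterator U}.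
Local Notation T := (oclass J).
Local Notation h := (@ostep U J).
Local Notation "B <=' C" := (val (B : T) `<=` val (C : T)) (at level 70).

Lemma oclass_ind (P : T -> Prop) :
  P (oempty J) -> (forall B, P B -> P (h B)) -> forall B, P B.
Proof.
move=> P0 PS B; suff : [set C | P C] = setT by move/seteqP => [_]; exact.
by apply: ominimal.
Qed.

Lemma oclass_anti {B C : T} : B <=' C -> C <=' B -> B = C.
Proof. by move=> BC CB; apply/val_inj/seteqP. Qed.

Lemma oempty_subset (B : T) : oempty J <=' B.
Proof. by []. Qed.

Lemma subset_step (B : T) : B <=' h B.
Proof. by move=> x Bx; have [_ ->] := gammaP B; left. Qed.

Lemma gamma_step (B : T) : val (h B) (val (gamma B)).
Proof. by have [_ ->] := gammaP B; right. Qed.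

Lemma step_nsubset (B : T) : ~ h B <=' B.
Proof. by move=> hB; have [+ _] := gammaP B; apply; exact/hB/gamma_step. Qed.

Lemma between_step {B C : T} : C <=' B -> B <=' h C -> B = C \/ B = h C.
Proof.
move=> CB BhC; have [Bc|Bc] := pselect (val B (val (gamma C))).
- right; apply: oclass_anti => // x; have [_ ->] := gammaP C.
  by case=> [/CB|->].
- left; apply: oclass_anti => // x Bx; move: (BhC x Bx).
  by have [_ ->] := gammaP C; case=> // xc; case: Bc; rewrite -xc.
Qed.

(** Stated asymmetrically, with the conclusion for a fixed B and all C at once,
    so that the outer induction hypothesis can be applied both to C and to h C
    in the inner induction. *)
Lemma subset_or_step_subset (B C : T) : C <=' B \/ h B <=' C.
Proof.
elim/oclass_ind: B C => [|B IHB] C; elim/oclass_ind: C => [|C IHC].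
- by left.
- right; case: IHC => [C0|h0C].
    by rewrite (oclass_anti C0 (oempty_subset C)).
  exact: subset_trans h0C (subset_step C).
- by left; exact: oempty_subset.
- case: IHC => [ChB|hhBC]; last first.
    by right; exact: subset_trans hhBC (subset_step C).
  have [CB|hBC] := IHB C; last by right; rewrite (oclass_anti ChB hBC).
  left; have [hCB|hBhC] := IHB (h C).
    exact: subset_trans hCB (subset_step B).
  (* Here C <= B < h B <= h C, which leaves room only for B = C. *)
  have [-> //|BhC] := between_step CB (subset_trans (subset_step B) hBhC).
  by case: (step_nsubset B); rewrite {2}BhC.
Qed.

Lemma subset_total (B C : T) : B <=' C \/ C <=' B.
Proof.
have [CB|hBC] := subset_or_step_subset B C; first by right.
by left; exact: subset_trans (subset_step B) hBC.
Qed.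

Lemma gamma_inj : injective (@gamma U J).
Proof.
have sub (B C : T) : gamma B = gamma C -> C <=' B.
  move=> BC; have [//|hBC] := subset_or_step_subset B C.
  by have [+ _] := gammaP C; case; rewrite -BC; exact/hBC/gamma_step.
by move=> B C BC; apply: oclass_anti; apply: sub.
Qed.

Lemma gamma_surj (c : dagger J) : exists B : T, gamma B = c.
Proof.
have [B [Bc hB]] := set_mem (valP c).
by exists B; apply: val_inj; rewrite -(gamma_unique Bc hB).
Qed.

Lemma gamma_bij : bijective (@gamma U J).
Proof.
pose g c := sval (cid (gamma_surj c)).
have gK : cancel g (@gamma U J) by move=> c; exact: svalP (cid (gamma_surj c)).
by exists g => // B; apply: gamma_inj; rewrite gK.
Qed.

Lemma ostep_inj : injective h.
Proof.
have sub (B C : T) : h B = h C -> C <=' B.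
  move=> BC; have [//|hBC] := subset_or_step_subset B C.
  by case: (step_nsubset C); rewrite -BC.
by move=> B C BC; apply: oclass_anti; apply: sub.
Qed.

Lemma peano_oiter : peano (oiter J).
Proof.
split; [exact: ominimal | exact: ostep_inj |].
by move=> [B _ /= hB0]; have := gamma_step B; rewrite hB0.
Qed.

(** Holds because C is built up from the empty set one label at a time; B is
    the stage just before x enters. *)
Lemma mem_step_subset {C : T} {x : U} :
  val C x -> exists2 B : T, h B <=' C & val (gamma B) = x.
Proof.
elim/oclass_ind: C => [//|C IHC]; have [_ hC] := gammaP C.
rewrite {1}hC => -[/IHC[B hBC Bx]|->]; last by exists C.
by exists B => //; exact: subset_trans hBC (subset_step C).
Qed.

(** The members of T between B and C are the iterates of h at B, so going up
    from B to C one step at a time and composing gives le B C.  Hence inclusion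
    is the least of the compatible preorders. *)
Lemma compatible_subset {le : relation T} :
  (forall B, le B B) -> (forall B C D, le B C -> le C D -> le B D) ->
  @compatible (oiter J) le -> forall B C : T, B <=' C -> le B C.
Proof.
move=> le_refl le_trans le_step B C; elim/oclass_ind: C => [|C IHC] BC.
  by rewrite (oclass_anti BC (oempty_subset B)).
have [/IHC leBC|hCB] := subset_or_step_subset C B.
  exact: le_trans leBC (le_step C).
by rewrite (oclass_anti BC hCB).
Qed.

(** * The iterator of labels *)

Context {ginv : dagger J -> T}.
Hypotheses (gammaK : cancel (@gamma U J) ginv)
           (ginvK : cancel ginv (@gamma U J)).

Lemma gamma_isomorphism :
  @iter_isomorphism (oiter J) (dagger_iter ginv) (@gamma U J).
Proof.
split; first by split=> //; apply/funext => B; rewrite /= /dagger_step /= gammaK.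
exists ginv; split; [split | exact/funext | exact/funext].
- exact: gammaK.
- by apply/funext => t; rewrite /= /dagger_step /= gammaK.
Qed.

Lemma ginv_step (t : dagger J) :
  val (h (ginv t)) = val (ginv t) `|` [set val t].
Proof. by have [_ ->] := gammaP (ginv t); rewrite ginvK. Qed.

Lemma dagger_le_total_order : total_order (dagger_le ginv).
Proof.
split; last by move=> x y; exact: subset_total.
split=> [x //|x y z xy yz|x y xy yx]; first exact: subset_trans xy yz.
by apply: (can_inj ginvK); exact: oclass_anti.
Qed.

Lemma dagger_le_compatible : @compatible (dagger_iter ginv) (dagger_le ginv).
Proof.
move=> t; rewrite /dagger_le /= /dagger_step /= gammaK; exact: subset_step.
Qed.

Lemma dagger_le_unique :
  unique (fun le : relation (dagger J) =>
            total_order le /\ @compatible (dagger_iter ginv) le)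
         (dagger_le ginv).
Proof.
split; first by split; [exact: dagger_le_total_order|exact: dagger_le_compatible].
move=> le [le_order le_step].
apply: (total_order_sub_eq dagger_le_total_order le_order) => x y xy.
have [[le_refl le_trans _] _] := le_order.
rewrite -(ginvK x) -(ginvK y).
apply: (@compatible_subset (fun B C => le (gamma B) (gamma C))) xy => //.
- by move=> B C D; exact: le_trans.
- by move=> B; have := le_step (gamma B); rewrite /= /dagger_step /= gammaK.
Qed.

(** For B different from C, inclusion of B in C amounts to that of h B, and
    hence to gamma B being one of the elements of C. *)
Lemma segmentE (t : dagger J) : segment ginv t = val (ginv t).
Proof.
apply/seteqP; split=> [_ [t' [le_t't t't] <-]|x /mem_step_subset[B hBt <-]].
- have [le_tt'|htt'] := subset_or_step_subset (ginv t') (ginv t).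
    by case: t't; apply: (can_inj ginvK); exact: oclass_anti.
  by rewrite -(ginvK t'); exact/htt'/gamma_step.
- exists (gamma B) => //; split.
    by rewrite /dagger_le gammaK; exact: subset_trans (subset_step B) hBt.
  by move=> Bt; apply: (step_nsubset B); rewrite -{2}(gammaK B) Bt.
Qed.

End Chain.

Theorem theorem8p4 (U : Type) (J : ordinal_iterator U) :
  (forall B : oclass J,
     ~ val B (val (gamma B)) /\
     val (ostep B) = val B `|` [set val (gamma B)]) /\
  (* (1) *)
  bijective (@gamma U J) /\
  forall ginv : dagger J -> oclass J,
    cancel (@gamma U J) ginv -> cancel ginv (@gamma U J) ->
    (* (2) *)
    (val (ostep (oempty J)) = [set val (start (dagger_iter ginv))] /\
     @iter_isomorphism (oiter J) (dagger_iter ginv) (@gamma U J)) /\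
    (* (3) *)
    peano (dagger_iter ginv) /\
    (* (4) *)
    (forall t : dagger J,
       val (ostep (ginv t)) = val (ginv t) `|` [set val t]) /\
    (* (5) *)
    unique (fun le : relation (dagger J) =>
              total_order le /\ @compatible (dagger_iter ginv) le)
           (dagger_le ginv) /\
    (* (6) *)
    (forall t : dagger J, segment ginv t = val (ginv t)) /\
    (* (7) *)
    (forall t : dagger J,
       exists Lt : segment ginv t \in oclass J,
         val (ostep (exist _ (segment ginv t) Lt)) =
           segment ginv t `|` [set val t]).
Proof.
split; first by move=> B; exact: gammaP.
split; first exact: gamma_bij.
move=> ginv gammaK ginvK.
have iso := gamma_isomorphism gammaK ginvK.
split; first split=> //.
  by have [_ ->] := gammaP (oempty J); rewrite set0U.
split; first exact: peano_isomorphism iso peano_oiter.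
split; first exact: ginv_step.
split; first exact: dagger_le_unique.
split; first exact: segmentE.
move=> t; have segE := segmentE gammaK ginvK t.
have Lt : segment ginv t \in oclass J by rewrite segE; exact: valP.
exists Lt; have -> : exist _ (segment ginv t) Lt = ginv t by exact: val_inj.
by rewrite ginv_step // segE.
Qed.
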